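(* For every SDM-sequent $\Gamma\Rightarrow\beta$, if $\mathsf{G3SDM}\vdash\Gamma\Rightarrow\beta$, then every partition of $\Gamma\Rightarrow\beta$ has an interpolant. That is, whenever $\Gamma$ is the multiset union of SDM-structures $\Gamma_1$ and $\Gamma_2$, there is a basic SDM-structure $\alpha$ such that (i) $\mathsf{G3SDM}\vdash\Gamma_1\Rightarrow\alpha$, (ii) $\mathsf{G3SDM}\vdash\alpha,\Gamma_2\Rightarrow\beta$, and (iii) $var(\alpha)\subseteq var(\Gamma_1)\cap var(\Gamma_2,\beta)$.
   Context: Let $\Xi=\{p_n\mid n\in\omega\}$ be a denumerable set of propositional variables. Terms are generated by $\varphi::=p\mid\bot\mid{\sim}\varphi\mid(\varphi\wedge\varphi)\mid(\varphi\vee\varphi)$ with $p\in\Xi$. A basic SDM-structure is an expression $\varphi$ or $*\varphi$ where $\varphi$ is a term ($*$ is a formal symbol). An SDM-structure is a finite (possibly empty) multiset of basic SDM-structures; the comma denotes multiset union. An SDM-sequent is $\Gamma\Rightarrow\alpha$ with $\Gamma$ an SDM-structure and $\alpha$ a basic SDM-structure. $var(\alpha)$ is the set of propositional variables occurring in $\alpha$, and $var(\alpha_1,\ldots,\alpha_n)=var(\alpha_1)\cup\cdots\cup var(\alpha_n)$. A partition of $\Gamma\Rightarrow\beta$ is $(\Gamma_1;\emptyset)(\Gamma_2;\beta)$ where the multiset union of $\Gamma_1$ and $\Gamma_2$ equals $\Gamma$; an interpolant of it is a basic SDM-structure $\alpha$ satisfying (i)--(iii) of the claim. The calculus $\mathsf{G3SDM}$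 (with $p\in\Xi$, $\varphi,\psi,\varphi_1,\varphi_2$ arbitrary terms, $\Gamma$ an arbitrary SDM-structure, $\beta$ an arbitrary basic SDM-structure) has axioms: $p,\Gamma\Rightarrow p$; $\bot,\Gamma\Rightarrow\beta$; $\Gamma\Rightarrow *\bot$; $*{\sim}\bot,\Gamma\Rightarrow\beta$. Rules: from $\varphi,\psi,\Gamma\Rightarrow\beta$ infer $\varphi\wedge\psi,\Gamma\Rightarrow\beta$; from $\Gamma\Rightarrow\varphi$ and $\Gamma\Rightarrow\psi$ infer $\Gamma\Rightarrow\varphi\wedge\psi$; from $\varphi,\Gamma\Rightarrow\beta$ and $\psi,\Gamma\Rightarrow\beta$ infer $\varphi\vee\psi,\Gamma\Rightarrow\beta$; from $\Gamma\Rightarrow\varphi_i$ ($i=1$ or $2$) infer $\Gamma\Rightarrow\varphi_1\vee\varphi_2$; from $*\varphi,*\psi,\Gamma\Rightarrow\beta$ infer $*(\varphi\vee\psi),\Gamma\Rightarrow\beta$; from $\Gamma\Rightarrow *\varphi$ and $\Gamma\Rightarrow *\psi$ infer $\Gamma\Rightarrow *(\varphi\vee\psi)$; from $*{\sim}\varphi,*{\sim}\psi,\Gamma\Rightarrow\beta$ infer $*{\sim}(\varphi\wedge\psi),\Gamma\Rightarrow\beta$; from $\Gamma\Rightarrow *{\sim}\varphi$ and $\Gamma\Rightarrow *{\sim}\psi$ infer $\Gamma\Rightarrow *{\sim}(\varphi\wedge\psi)$; from $*\varphi,\Gamma\Rightarrow\beta$ infer $*{\sim}{\sim}\varphi,\Gamma\Rightarrow\beta$;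 from $\Gamma\Rightarrow *\varphi$ infer $\Gamma\Rightarrow *{\sim}{\sim}\varphi$; from $*\varphi,\Gamma\Rightarrow\beta$ infer ${\sim}\varphi,\Gamma\Rightarrow\beta$; from $\Gamma\Rightarrow *\varphi$ infer $\Gamma\Rightarrow{\sim}\varphi$; and the structural rule $( * )$: from $\varphi\Rightarrow\psi$ infer $*\psi,\Gamma\Rightarrow *\varphi$. $\mathsf{G3SDM}\vdash\Gamma\Rightarrow\alpha$ means that $\Gamma\Rightarrow\alpha$ has a derivation from these axioms by these rules. *)

(* Defs.v *)
From HB Require Import structures.
From mathcomp Require Import all_boot finmap multiset.

Set Implicit Arguments.
Unset Strict Implicit.
Unset Printing Implicit Defensive.

Inductive term : Type :=
| Var of nat
| Bot
| Neg of term
| And of term & term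
| Or of term & term.

(* [Star f] is the formal expression [*f]; the symbol [*] is not iterated. *)
Inductive bstruct : Type :=
| Term of term
| Star of term.

Coercion Term : term >-> bstruct.

(* Encodings into trees: {mset bstruct} requires a choiceType. *)
Fixpoint term_encode (f : term) : GenTree.tree nat :=
  match f with
  | Var n => GenTree.Leaf n
  | Bot => GenTree.Node 0 [::]
  | Neg g => GenTree.Node 1 [:: term_encode g]
  | And g h => GenTree.Node 2 [:: term_encode g; term_encode h]
  | Or g h => GenTree.Node 3 [:: term_encode g; term_encode h]
  end.

Fixpoint term_decode (t : GenTree.tree nat) : option term :=
  match t with
  | GenTree.Leaf n => Some (Var n)
  | GenTree.Node 0 [::] => Some Bot
  | GenTree.Node 1 [:: u] => omap Neg (term_decode u)
  | GenTree.Node 2 [:: u; v] =>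
      obind (fun g => omap (And g) (term_decode v)) (term_decode u)
  | GenTree.Node 3 [:: u; v] =>
      obind (fun g => omap (Or g) (term_decode v)) (term_decode u)
  | _ => None
  end.

Lemma term_encodeK : pcancel term_encode term_decode.
Proof. by elim=> //= [g -> | g -> h -> | g -> h ->]. Qed.

HB.instance Definition _ := Countable.copy term (pcan_type term_encodeK).

Definition bstruct_encode (a : bstruct) : term + term :=
  match a with Term f => inl f | Star f => inr f end.

Definition bstruct_decode (s : term + term) : bstruct :=
  match s with inl f => Term f | inr f => Star f end.

Lemma bstruct_encodeK : cancel bstruct_encode bstruct_decode.
Proof. by case. Qed.

HB.instance Definition _ := Countable.copy bstruct (can_type bstruct_encodeK).

Notation structure := {mset bstruct}%mset.

Local Open Scope fset_scope.

Fixpoint term_var (f : term) : {fset nat} :=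
  match f with
  | Var n => [fset n]
  | Bot => fset0
  | Neg g => term_var g
  | And g h | Or g h => term_var g `|` term_var h
  end.

Definition bvar (a : bstruct) : {fset nat} :=
  match a with Term f | Star f => term_var f end.

Definition svar (G : structure) : {fset nat} := \bigcup_(a <- G) bvar a.

Local Close Scope fset_scope.
Local Open Scope mset_scope.

Inductive G3SDM : structure -> bstruct -> Prop :=
| ax_var n (G : structure) : G3SDM (Term (Var n) +` G) (Var n)
| ax_botL (G : structure) b : G3SDM (Term Bot +` G) b
| ax_starbotR (G : structure) : G3SDM G (Star Bot)
| ax_starnegbotL (G : structure) b : G3SDM (Star (Neg Bot) +` G) b
| rule_andL (f g : term) (G : structure) b :
    G3SDM (Term f +` (Term g +` G)) b -> G3SDM (Term (And f g) +` G) b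
| rule_andR (f g : term) (G : structure) :
    G3SDM G f -> G3SDM G g -> G3SDM G (And f g)
| rule_orL (f g : term) (G : structure) b :
    G3SDM (Term f +` G) b -> G3SDM (Term g +` G) b ->
    G3SDM (Term (Or f g) +` G) b
| rule_orR1 (f g : term) (G : structure) : G3SDM G f -> G3SDM G (Or f g)
| rule_orR2 (f g : term) (G : structure) : G3SDM G g -> G3SDM G (Or f g)
| rule_starorL (f g : term) (G : structure) b :
    G3SDM (Star f +` (Star g +` G)) b -> G3SDM (Star (Or f g) +` G) b
| rule_starorR (f g : term) (G : structure) :
    G3SDM G (Star f) -> G3SDM G (Star g) -> G3SDM G (Star (Or f g))
| rule_starnegandL (f g : term) (G : structure) b :
    G3SDM (Star (Neg f) +` (Star (Neg g) +` G)) b ->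
    G3SDM (Star (Neg (And f g)) +` G) b
| rule_starnegandR (f g : term) (G : structure) :
    G3SDM G (Star (Neg f)) -> G3SDM G (Star (Neg g)) ->
    G3SDM G (Star (Neg (And f g)))
| rule_starnegnegL (f : term) (G : structure) b :
    G3SDM (Star f +` G) b -> G3SDM (Star (Neg (Neg f)) +` G) b
| rule_starnegnegR (f : term) (G : structure) :
    G3SDM G (Star f) -> G3SDM G (Star (Neg (Neg f)))
| rule_negL (f : term) (G : structure) b :
    G3SDM (Star f +` G) b -> G3SDM (Term (Neg f) +` G) b
| rule_negR (f : term) (G : structure) :
    G3SDM G (Star f) -> G3SDM G (Neg f)
| rule_star (f g : term) (G : structure) :
    G3SDM [mset Term f] g -> G3SDM (Star g +` G) (Star f).

(* [G1] and [G2] are the two parts of the partition (G1; )(G2; b) of a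
   sequent G => b, where G is the multiset sum of G1 and G2. *)
Definition interpolant (G1 G2 : structure) (b a : bstruct) : Prop :=
  [/\ G3SDM G1 a,
      G3SDM (a +` G2) b
    & (bvar a `<=` svar G1 `&` svar (b +` G2))%fset].

(* Main.v *)
Require Import Defs.
From mathcomp Require Import all_boot finmap multiset.

(** The proof is Maehara's induction on a derivation of G => b, carried out for
    all splittings of G at once.  An axiom whose principal formula lies in the
    first part is interpolated by that formula or by falsum; if it lies in the
    second part, or on the right, a derivable formula does.  A rule acting on
    the second part or on the succedent keeps the interpolant of its premise,
    or takes the conjunction of the interpolants of its two premises
    ([transfer_interp], [meet_interp]); a rule acting on the first part keeps
    it, or takes the disjunction ([left_rule_interp], [orL_interp]).

    Two obstacles are specific to this calculus.  Conjunction and disjunction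
    only apply to terms, whereas an interpolant may be starred.  But [*h] and
    [~h] are interchangeable for this purpose: [~h] is derived on the right
    from [*h], and [*h] may be replaced by [~h] on the left, with the same
    variables.  So the induction can maintain that the interpolant is a term
    ([term_interp_of]), which is stronger than what is claimed.

    The other one is the contrapositive rule, from [f => g] to
    [*g, G => *f].  If [*g] is in the first part, an interpolating term [h]
    of [f => g] turns into [*h], the rule being applied once to each half:
    [*g => *h] and [*h => *f].  This step again needs [h] to be a term, since
    stars do not iterate.  If [*g] is in the second part, the context of the
    conclusion is arbitrary, so a derivable formula can simply be added to
    it. *)

Set Implicit Arguments.
Unset Strict Implicit.
Unset Printing Implicit Defensive.

Local Open Scope mset_scope.

(** * Multisets and their variables *)

Lemma svarD (A B : structure) : svar (A `+` B) = (svar A `|` svar B)%fset.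
Proof.
apply/fsetP=> n; rewrite in_fsetU; apply/bigfcupP/orP.
  move=> [a]; rewrite andbT in_msetD => /orP[] aA na; [left|right];
    by apply/bigfcupP; exists a; rewrite // andbT.
by case=> /bigfcupP[a]; rewrite andbT => aA na; exists a;
  rewrite // andbT in_msetD aA ?orbT.
Qed.

Lemma svar1 a : svar [mset a] = bvar a.
Proof. by rewrite /svar enum_msetn /= big_seq1. Qed.

Lemma svar0 : svar mset0 = fset0.
Proof. by rewrite /svar enum_mset0 big_nil. Qed.

Lemma mset1D_eq_msetD (T : choiceType) (x : T) (G A B : {mset T}) :
  x +` G = A `+` B ->
  (exists2 A', A = x +` A' & G = A' `+` B) \/
  (exists2 B', B = x +` B' & G = A `+` B').
Proof.
move=> E; have : x \in A `+` B by rewrite -E in_mset1D eqxx.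
have cancel_x H : x +` G = x +` H -> G = H.
  by move=> /(congr1 (fun C => C `\ x)); rewrite !msetD1K.
rewrite in_msetD => /orP[] xin; [left; exists (A `\ x) | right; exists (B `\ x)];
  rewrite ?msetB1K //; apply: cancel_x.
- by rewrite msetDA msetB1K.
- by rewrite msetDCA msetB1K.
Qed.

(** * Weakening *)

(** Every axiom and every rule carries an arbitrary context, so a formula can
    be pushed up the derivation; the contrapositive rule, whose premise has no
    context, absorbs it in its conclusion. *)
Lemma weakening a G b : G3SDM G b -> G3SDM (a +` G) b.
Proof.
elim=> {G b}.
- by move=> n G; rewrite msetDCA; apply: ax_var.
- by move=> G b; rewrite msetDCA; apply: ax_botL.
- by move=> G; apply: ax_starbotR.
- by move=> G b; rewrite msetDCA; apply: ax_starnegbotL.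
- move=> f g G b _ IH; rewrite msetDCA; apply: rule_andL.
  by rewrite [Term g +` _]msetDCA [Term f +` _]msetDCA.
- by move=> f g G _ IHf _ IHg; apply: rule_andR.
- move=> f g G b _ IHf _ IHg; rewrite msetDCA.
  by apply: rule_orL; rewrite msetDCA.
- by move=> f g G _ IH; apply: rule_orR1.
- by move=> f g G _ IH; apply: rule_orR2.
- move=> f g G b _ IH; rewrite msetDCA; apply: rule_starorL.
  by rewrite [Star g +` _]msetDCA [Star f +` _]msetDCA.
- by move=> f g G _ IHf _ IHg; apply: rule_starorR.
- move=> f g G b _ IH; rewrite msetDCA; apply: rule_starnegandL.
  by rewrite [Star (Neg g) +` _]msetDCA [Star (Neg f) +` _]msetDCA.
- by move=> f g G _ IHf _ IHg; apply: rule_starnegandR.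
- move=> f G b _ IH; rewrite msetDCA.
  by apply: rule_starnegnegL; rewrite msetDCA.
- by move=> f G _ IH; apply: rule_starnegnegR.
- by move=> f G b _ IH; rewrite msetDCA; apply: rule_negL; rewrite msetDCA.
- by move=> f G _ IH; apply: rule_negR.
- by move=> f g G d _; rewrite msetDCA; apply: rule_star.
Qed.

(** * Interpolating terms *)

Definition term_interp (G1 G2 : structure) (b : bstruct) : Prop :=
  exists f : term, interpolant G1 G2 b f.

Definition interpolable (G : structure) (b : bstruct) : Prop :=
  forall G1 G2 : structure, G = G1 `+` G2 -> term_interp G1 G2 b.

(** A starred interpolant [*h] may be traded for the term [~h]. *)
Lemma term_interp_of G1 G2 b a : interpolant G1 G2 b a -> term_interp G1 G2 b.
Proof.
case: a => [f I | f [I1 I2 I3]]; first by exists f.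
by exists (Neg f); split=> //; [apply: rule_negR | apply: rule_negL].
Qed.

(** When the first part is irrelevant, the derivable formula [*Bot], which has
    no variables, interpolates. *)
Lemma trivial_interp G1 G2 b :
  (forall a, G3SDM (a +` G2) b) -> term_interp G1 G2 b.
Proof.
move=> d; apply: (@term_interp_of _ _ _ (Star Bot)).
by split; [apply: ax_starbotR | apply: d | apply: fsub0set].
Qed.

Lemma inconsistent_interp (G1 G2 : structure) b :
  G3SDM G1 Bot -> term_interp G1 G2 b.
Proof.
by move=> d; exists Bot; split; [|apply: ax_botL|apply: fsub0set].
Qed.

Lemma transfer_interp (G1 H' H : structure) b' b :
  (forall G, G3SDM (G `+` H') b' -> G3SDM (G `+` H) b) ->
  (svar (b' +` H') `<=` svar (b +` H))%fset ->
  term_interp G1 H' b' -> term_interp G1 H b.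
Proof.
move=> rule sub [f [d1 d2 v]]; exists f; split=> //; first exact: rule.
exact: fsubset_trans v (fsetIS _ sub).
Qed.

(** The left part proves both interpolants, hence their conjunction; the
    conjunction unfolds on the left, and weakening gives each premise of the
    rule the interpolant that it lacks. *)
Lemma meet_interp (G1 H1 H2 H : structure) b1 b2 b :
  (forall G, G3SDM (G `+` H1) b1 -> G3SDM (G `+` H2) b2 -> G3SDM (G `+` H) b) ->
  (svar (b1 +` H1) `<=` svar (b +` H))%fset ->
  (svar (b2 +` H2) `<=` svar (b +` H))%fset ->
  term_interp G1 H1 b1 -> term_interp G1 H2 b2 -> term_interp G1 H b.
Proof.
move=> rule sub1 sub2 [f [df1 df2 vf]] [g [dg1 dg2 vg]].
exists (And f g); split; first exact: rule_andR.
  apply: rule_andL; rewrite msetDA; apply: rule; rewrite -msetDA.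
    by rewrite msetDCA; apply: weakening.
  exact: weakening.
rewrite /= fsubUset (fsubset_trans vf (fsetIS _ sub1)).
exact: fsubset_trans vg (fsetIS _ sub2).
Qed.

(** * Rules on the left *)

(** [D] is the multiset of formulas that replaces the principal formula [x] in
    the premise.  Since the context and the succedent of the rule are
    arbitrary, it can be applied to whichever half contains [x]. *)
Lemma left_rule_interp (D : structure) x G b :
  (forall H c, G3SDM (D `+` H) c -> G3SDM (x +` H) c) ->
  (svar D `<=` bvar x)%fset ->
  interpolable (D `+` G) b -> interpolable (x +` G) b.
Proof.
move=> rule sub IH G1 G2 /mset1D_eq_msetD[] [H -> E].
  have /IH[f [d1 d2 v]] : D `+` G = (D `+` H) `+` G2 by rewrite E msetDA.
  exists f; split=> //; first exact: rule.
  apply: fsubset_trans v (fsetSI _ _).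
  by rewrite !svarD svar1 fsetSU.
have /IH : D `+` G = G1 `+` (D `+` H) by rewrite E msetDCA.
apply: transfer_interp.
  by move=> K; rewrite msetDCA [_ `+` (x +` H)]msetDCA; apply: rule.
by rewrite !svarD !svar1 fsetUS // fsetSU.
Qed.

Lemma orL_interp (f g : term) G b :
  interpolable (Term f +` G) b -> interpolable (Term g +` G) b ->
  interpolable (Term (Or f g) +` G) b.
Proof.
move=> IHf IHg G1 G2 /mset1D_eq_msetD[] [H -> E].
  have /IHf[h [d1 d2 v]] : Term f +` G = (Term f +` H) `+` G2.
    by rewrite E msetDA.
  have /IHg[k [e1 e2 w]] : Term g +` G = (Term g +` H) `+` G2.
    by rewrite E msetDA.
  exists (Or h k); split.
  - by apply: rule_orL; [apply: rule_orR1 | apply: rule_orR2].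
  - exact: rule_orL.
  - rewrite /= fsubUset; apply/andP; split.
      apply: fsubset_trans v (fsetSI _ _).
      by rewrite !svarD !svar1 /= fsetSU // fsubsetUl.
    apply: fsubset_trans w (fsetSI _ _).
    by rewrite !svarD !svar1 /= fsetSU // fsubsetUr.
have /IHf If : Term f +` G = G1 `+` (Term f +` H) by rewrite E msetDCA.
have /IHg Ig : Term g +` G = G1 `+` (Term g +` H) by rewrite E msetDCA.
apply: meet_interp If Ig.
- by move=> K; rewrite !(msetDCA K); apply: rule_orL.
- by rewrite !svarD !svar1 /= fsetUS // fsetSU // fsubsetUl.
- by rewrite !svarD !svar1 /= fsetUS // fsetSU // fsubsetUr.
Qed.

(** * Rules on the right *)

Lemma right_rule_interp G b' b :
  (forall H, G3SDM H b' -> G3SDM H b) -> (bvar b' `<=` bvar b)%fset ->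
  interpolable G b' -> interpolable G b.
Proof.
move=> rule sub IH G1 G2 /IH; apply: transfer_interp; first by move=> K; apply: rule.
by rewrite !svarD !svar1 fsetSU.
Qed.

Lemma right_rule2_interp G b1 b2 b :
  (forall H, G3SDM H b1 -> G3SDM H b2 -> G3SDM H b) ->
  (bvar b1 `|` bvar b2 `<=` bvar b)%fset ->
  interpolable G b1 -> interpolable G b2 -> interpolable G b.
Proof.
rewrite fsubUset => rule /andP[s1 s2] IH1 IH2 G1 G2 E.
apply: meet_interp (IH1 _ _ E) (IH2 _ _ E).
- by move=> K; apply: rule.
- by rewrite !svarD !svar1 fsetSU.
- by rewrite !svarD !svar1 fsetSU.
Qed.

(** * The contrapositive rule *)

Lemma star_interp (f g : term) G :
  G3SDM [mset Term f] g -> interpolable [mset Term f] g ->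
  interpolable (Star g +` G) (Star f).
Proof.
move=> d IH G1 G2 /mset1D_eq_msetD[] [H -> E]; last first.
  by apply: trivial_interp => a; rewrite msetDCA; apply: rule_star.
have /IH[h [d1 d2 v]] : [mset Term f] = [mset Term f] `+` mset0.
  by rewrite msetD0.
rewrite msetD0 in d2.
apply: (@term_interp_of _ _ _ (Star h)); split; try exact: rule_star.
move: v; rewrite !svarD !svar1 svar0 fsetU0 /= !fsubsetI => /andP[vf vg].
apply/andP; split; last exact: fsubset_trans vf (fsubsetUl _ _).
exact: fsubset_trans vg (fsubsetUl _ _).
Qed.

(** * Interpolation *)

Theorem theorem3p15 (G : structure) (b : bstruct) :
  G3SDM G b ->
  forall G1 G2 : structure, G = (G1 `+` G2)%mset ->
  exists a : bstruct, interpolant G1 G2 b a.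
Proof.
suff interp : G3SDM G b -> interpolable G b.
  by move=> d G1 G2 /(interp d)[f I]; exists f.
elim=> {G b}.
- move=> n G G1 G2 /mset1D_eq_msetD[] [H -> _]; last first.
    by apply: trivial_interp => a; rewrite msetDCA; apply: ax_var.
  exists (Var n); split; try exact: ax_var.
  by rewrite !svarD !svar1 fsubsetI !fsubsetUl.
- move=> G b G1 G2 /mset1D_eq_msetD[] [H -> _]; last first.
    by apply: trivial_interp => a; rewrite msetDCA; apply: ax_botL.
  exact/inconsistent_interp/ax_botL.
- by move=> G G1 G2 _; apply: trivial_interp => a; apply: ax_starbotR.
- move=> G b G1 G2 /mset1D_eq_msetD[] [H -> _]; last first.
    by apply: trivial_interp => a; rewrite msetDCA; apply: ax_starnegbotL.
  exact/inconsistent_interp/ax_starnegbotL.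
- move=> f g G b _; rewrite msetDA; apply: left_rule_interp.
    by move=> H c; rewrite -msetDA; apply: rule_andL.
  by rewrite svarD !svar1.
- move=> f g G _ IHf _ IHg.
  by apply: right_rule2_interp IHf IHg => // H; apply: rule_andR.
- by move=> f g G b _ IHf _ IHg; apply: orL_interp.
- move=> f g G _; apply: right_rule_interp; last exact: fsubsetUl.
  by move=> H; apply: rule_orR1.
- move=> f g G _; apply: right_rule_interp; last exact: fsubsetUr.
  by move=> H; apply: rule_orR2.
- move=> f g G b _; rewrite msetDA; apply: left_rule_interp.
    by move=> H c; rewrite -msetDA; apply: rule_starorL.
  by rewrite svarD !svar1.
- move=> f g G _ IHf _ IHg.
  by apply: right_rule2_interp IHf IHg => // H; apply: rule_starorR.
- move=> f g G b _; rewrite msetDA; apply: left_rule_interp.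
    by move=> H c; rewrite -msetDA; apply: rule_starnegandL.
  by rewrite svarD !svar1.
- move=> f g G _ IHf _ IHg.
  by apply: right_rule2_interp IHf IHg => // H; apply: rule_starnegandR.
- move=> f G b _; apply: left_rule_interp; last by rewrite svar1.
  exact: rule_starnegnegL.
- by move=> f G _; apply: right_rule_interp => // H; apply: rule_starnegnegR.
- move=> f G b _; apply: left_rule_interp; last by rewrite svar1.
  exact: rule_negL.
- by move=> f G _; apply: right_rule_interp => // H; apply: rule_negR.
- by move=> f g G; apply: star_interp.
Qed.
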